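(* Let $(G,B,m,w)$ be a connected weighted finite graph with boundary. (1) If $(G,m,w)$ satisfies the Bakry–Émery curvature-dimension condition $\mathrm{CD}(K,n)$ with $K>0$ and $n>1$, then $\nu_2\ge\frac{nK}{n-1}$. (2) If the Ollivier curvature of $(G,m,w)$ has a positive lower bound $\kappa$, then $\nu_2\ge\kappa$.
   Context: A weighted finite graph $(G,m,w)$ is a finite simple graph $G$ with vertex set $V$ and edge set $E$, a vertex-measure $m:V\to(0,\infty)$ and an edge-weight $w:E\to(0,\infty)$; $w$ is extended to a symmetric function on $V\times V$ by $w_{xy}=0$ when $\{x,y\}\notin E$. A weighted finite graph with boundary $(G,B,m,w)$ is a weighted finite graph with a nonempty subset $B\subset V$ (the boundary); $\Omega=V\setminus B$ is the interior. $\mathbb{R}^S$ is the space of real functions on $S$, with inner product $\langle u,v\rangle_S=\sum_{x\in S}u(x)v(x)m_x$. Laplacian: $\Delta u(x)=\frac1{m_x}\sum_{y\in V}(u(x)-u(y))w_{xy}$ for $u\in\mathbb{R}^V$. Neumann Laplacian: for $u\in\mathbb{R}^\Omega$, let $N_0(u)\in\mathbb{R}^V$ be the unique function with $N_0(u)=u$ on $\Omega$ and $\Delta N_0(u)=0$ on $B$. Set $\Delta^N u=(\Delta N_0(u))|_\Omega$, a nonnegative self-adjoint operator on $\mathbb{R}^\Omega$ with eigenvalues (Neumann eigenvalues), counted with multiplicity, $0\le\nu_1\le\nu_2\le\dots\le\nu_{|\Omega|}$; by convention $\nu_i=+\infty$ when $i>|\Omega|$. Bakry–Émery condition: put $L=-\Delta$,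 $\Gamma(f,g)=\frac12\left(L(fg)-fLg-gLf\right)$ and $\Gamma_2(f,f)=\frac12L\Gamma(f,f)-\Gamma(f,Lf)$. $(G,m,w)$ satisfies $\mathrm{CD}(K,n)$ if $\Gamma_2(f,f)(x)\ge\frac1n(Lf(x))^2+K\,\Gamma(f,f)(x)$ for all $f\in\mathbb{R}^V$ and $x\in V$. Ollivier curvature (Münch–Wojciechowski, general weighted graphs): let $d$ be the combinatorial graph distance on $V$. For $x\ne y$ in $V$, $$\kappa(x,y)=\inf\left\{\frac{\Delta f(y)-\Delta f(x)}{d(x,y)}\ \Big|\ f\in\mathbb{R}^V\text{ is 1-Lipschitz for }d\text{ and } f(y)-f(x)=d(x,y)\right\}.$$ The Ollivier curvature has lower bound $\kappa$ if $\kappa(x,y)\ge\kappa$ for all $x\ne y$ in $V$. *)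

(* Defs.v *)
From HB Require Import structures.
From mathcomp Require Import all_boot all_order all_algebra.
From mathcomp Require Import all_classical all_reals all_analysis.

Set Implicit Arguments.
Unset Strict Implicit.
Unset Printing Implicit Defensive.

Import Order.TTheory GRing.Theory Num.Theory.
Local Open Scope classical_set_scope.
Local Open Scope ring_scope.

(* The edge weight is carried in its extended form: a symmetric function on
   V * V, positive exactly on edges and zero elsewhere. *)
Record weighted_graph (R : realType) (V : finType) := WeightedGraph {
  edge : rel V;
  edge_sym : symmetric edge;
  edge_irr : irreflexive edge;
  meas : V -> R;
  meas_gt0 : forall x, 0 < meas x;
  weight : V -> V -> R;
  weight_sym : forall x y, weight x y = weight y x;
  weight_gt0 : forall x y, edge x y -> 0 < weight x y;
  weight_eq0 : forall x y, ~~ edge x y -> weight x y = 0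
}.

Definition connected_graph (R : realType) (V : finType)
    (G : weighted_graph R V) : Prop :=
  forall x y : V, connect (edge G) x y.

Definition laplacian (R : realType) (V : finType) (G : weighted_graph R V)
    (u : V -> R) (x : V) : R :=
  (meas G x)^-1 * \sum_(y : V) (u x - u y) * weight G x y.

Definition interior_vertex (V : finType) (B : {set V}) : finType :=
  {x : V | x \in ~: B}.

Definition is_neumann_extension (R : realType) (V : finType)
    (G : weighted_graph R V) (B : {set V})
    (u : interior_vertex B -> R) (v : V -> R) : Prop :=
  (forall z : interior_vertex B, v (val z) = u z) /\
  (forall x, x \in B -> laplacian G v x = 0).

(* [xget] selects the function satisfying the predicate. On a connected graph
   with a nonempty interior it exists and is unique; the default value 0 is
   only relevant otherwise. *)
Definition neumann_extension (R : realType) (V : finType)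
    (G : weighted_graph R V) (B : {set V}) (u : interior_vertex B -> R) :
    V -> R :=
  xget (fun=> 0) [set v : V -> R | is_neumann_extension G u v].

Definition neumann_laplacian (R : realType) (V : finType)
    (G : weighted_graph R V) (B : {set V}) (u : interior_vertex B -> R) :
    interior_vertex B -> R :=
  fun z => laplacian G (neumann_extension G u) (val z).

(* Matrix, acting on column vectors, of an operator on real functions on T
   in the basis of indicator functions of points. *)
Definition operator_mx (R : realType) (T : finType)
    (A : (T -> R) -> (T -> R)) : 'M[R]_#|T| :=
  \matrix_(i, j) A (fun z => (z == enum_val j)%:R) (enum_val i).

(* Nondecreasing list of the eigenvalues with multiplicity. It is unique when
   it exists, i.e. when all the eigenvalues are real, and is the empty list
   otherwise. *)
Definition eigenvalues (R : realType) (n : nat) (A : 'M[R]_n) : seq R :=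
  xget [::] [set s : seq R |
    sorted <=%R s /\ char_poly A = \prod_(a <- s) ('X - a%:P)].

(* The index i is numbered from 1. *)
Definition neumann_eigenvalue (R : realType) (V : finType)
    (G : weighted_graph R V) (B : {set V}) (i : nat) : \bar R :=
  if (i <= #|~: B|)%N then
    (nth 0 (eigenvalues (operator_mx (neumann_laplacian G (B := B)))) i.-1)%:E
  else +oo%E.

Definition gen (R : realType) (V : finType) (G : weighted_graph R V)
    (f : V -> R) : V -> R :=
  fun x => - laplacian G f x.

Definition Gamma (R : realType) (V : finType) (G : weighted_graph R V)
    (f g : V -> R) : V -> R :=
  fun x => 2^-1 * (gen G (fun y => f y * g y) x
                   - f x * gen G g x - g x * gen G f x).

(* The diagonal Gamma_2(f, f). *)
Definition Gamma2 (R : realType) (V : finType) (G : weighted_graph R V)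
    (f : V -> R) : V -> R :=
  fun x => 2^-1 * gen G (Gamma G f f) x - Gamma G f (gen G f) x.

Definition bakry_emery_CD (R : realType) (V : finType)
    (G : weighted_graph R V) (K n : R) : Prop :=
  forall (f : V -> R) (x : V),
    n^-1 * gen G f x ^+ 2 + K * Gamma G f f x <= Gamma2 G f x.

(* Least length of an edge path from x to y. A shortest path has fewer than
   #|V| edges, so the default #|V| is taken only when there is no path. *)
Definition graph_dist (R : realType) (V : finType) (G : weighted_graph R V)
    (x y : V) : nat :=
  \big[minn/#|V|]_(k < #|V| |
    [exists p : k.-tuple V, path (edge G) x p && (last x p == y)]) k.

Definition lipschitz1 (R : realType) (V : finType) (G : weighted_graph R V)
    (f : V -> R) : Prop :=
  forall x y, `|f x - f y| <= (graph_dist G x y)%:R.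

Definition ollivier_curvature (R : realType) (V : finType)
    (G : weighted_graph R V) (x y : V) : \bar R :=
  ereal_inf [set ((laplacian G f y - laplacian G f x)
                    / (graph_dist G x y)%:R)%:E
            | f in [set f : V -> R | lipschitz1 G f /\
                                     f y - f x = (graph_dist G x y)%:R]].

Definition ollivier_lower_bound (R : realType) (V : finType)
    (G : weighted_graph R V) (kappa : R) : Prop :=
  forall x y, x != y -> (kappa%:E <= ollivier_curvature G x y)%E.

(* Main.v *)
(* The Neumann extension v of a nonconstant Neumann eigenfunction u with
   eigenvalue nu has Dirichlet energy nu |u|^2, and after subtraction of its
   mean its norm on V is at least |u|, because u is orthogonal to the constants
   on the interior. Hence a Poincare inequality with constant c on the whole
   graph gives c <= nu, and only one member of an eigenbasis of the Neumann
   Laplacian can be constant. The Poincare inequality on the whole graph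
   follows from a bound on the nonconstant eigenfunctions f of the Laplacian,
   with eigenvalue a. Under CD(K, n), integrating the condition for f yields
   a^2 / n + K a <= a^2. Under a positive Ollivier bound, f rescaled to
   Lipschitz constant 1 is a test function at a pair of points where the
   Lipschitz constant is attained, and the quotient there equals a. *)
Require Import Defs.
From HB Require Import structures.
From mathcomp Require Import all_boot all_order all_algebra.
From mathcomp Require Import all_classical all_reals all_analysis.
From mathcomp Require Import complex ring lra.

Set Implicit Arguments.
Unset Strict Implicit.
Unset Printing Implicit Defensive.

Import Order.TTheory GRing.Theory Num.Theory.
Local Open Scope ring_scope.

(** * Diagonalization of real symmetric matrices *)

(** Over [R[i]] the matrix is Hermitian, hence unitarily diagonalizable with real spectrum; real
    matrices similar over [R[i]] are similar over [R]. The rows of [P] are left eigenvectors. *)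
Lemma symmetric_mx_diagonalization (R : rcfType) (n : nat) (S : 'M[R]_n) :
  S^T = S ->
  exists2 P : 'M[R]_n, P \in unitmx &
    exists d : 'rV[R]_n, P *m S = diag_mx d *m P.
Proof.
move=> symS; pose toC := real_complex R.
have realC p q (X : 'M[R]_(p, q)) : map_mx toC X \is a mxOver Num.real.
  by apply/mxOverP => i j; rewrite mxE; apply/complex_realP; exists (X i j).
have Creal p q (X : 'M[R[i]]_(p, q)) :
    X \is a mxOver Num.real -> X = map_mx toC (map_mx (@complex.Re R) X).
  by move=> /mxOverP Xr; apply/matrixP => i j; rewrite !mxE /toC RRe_real.
have hermS : map_mx toC S \is hermsymmx.
  apply: realsym_hermsym (realC _ _ S).
  apply/is_hermitianmxP; rewrite expr0 scale1r map_mx_id//.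
  by rewrite map_trmx symS.
have /hermitian_normalmx/orthomx_spectralP := hermS.
have := hermitian_spectral_diag_real hermS.
move: (spectral_diag _) (spectralmx _) (spectral_unit (map_mx toC S)) => D U Uu.
move=> /Creal -> SE.
move: SE; set d := map_mx _ D; rewrite -map_diag_mx => SE.
have simS : similar_in unitmx (map_mx toC S) (map_mx toC (diag_mx d)).
  by exists U => //; apply/similarP => //; rewrite {1}SE !mulmxA mulmxV// mul1mx.
have [P /andP[/Creal PE Pu]] := real_similar simS (realC _ _ _) (realC _ _ _).
move/(similarP Pu); rewrite PE -!map_mxM => /map_mx_inj PS.
exists (map_mx (@complex.Re R) P); last by exists d.
by move: Pu; rewrite /= {1}PE map_unitmx.
Qed.

Lemma char_poly_similar (R : fieldType) (n : nat) (P A B : 'M[R]_n) :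
  P \in unitmx -> P *m A = B *m P -> char_poly A = char_poly B.
Proof.
move=> Pu PAB; pose Q := map_mx (@polyC R) P.
have Q0 : \det Q != 0.
  by rewrite det_map_mx polyC_eq0 -unitfE -unitmxE.
apply: (mulfI Q0); rewrite [RHS]mulrC -!det_mulmx /char_poly_mx.
by rewrite mulmxBr mulmxBl scalar_mxC -!map_mxM PAB.
Qed.

(** * Self-adjoint operators on finite weighted spaces *)

(** Generic in [T] and [m], so as to serve both on [V] and on the interior with the restricted
    measure. *)
Definition wdot (R : realType) (T : finType) (m : T -> R) (u v : T -> R) : R :=
  \sum_x m x * (u x * v x).

Definition linear_op (R : realType) (T : finType) (A : (T -> R) -> T -> R) :=
  forall (a : R) (u v : T -> R) (x : T),
    A (fun y => a * u y + v y) x = a * A u x + A v x.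

Definition selfadjoint_op (R : realType) (T : finType) (m : T -> R)
    (A : (T -> R) -> T -> R) :=
  forall u v : T -> R, wdot m (A u) v = wdot m u (A v).

Lemma linear_op_sum (R : realType) (T : finType) (A : (T -> R) -> T -> R)
    (I : Type) (r : seq I) (c : I -> R) (f : I -> T -> R) (x : T) :
  linear_op A ->
  A (fun y => \sum_(i <- r) c i * f i y) x = \sum_(i <- r) c i * A (f i) x.
Proof.
move=> linA; elim: r x => [|i r IH] x.
  (* With [a = 1] and zero functions, linearity reads [A 0 = A 0 + A 0], so [A 0 = 0]. *)
  have A0 := linA 1 (fun=> 0) (fun=> 0) x.
  rewrite big_nil; under eq_fun do rewrite big_nil.
  move: A0; under eq_fun do rewrite mulr0 addr0.
  by move/eqP; rewrite mul1r -subr_eq subrr eq_sym => /eqP.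
rewrite big_cons -IH -linA; congr (A _ x).
by apply/funext => y; rewrite big_cons.
Qed.

Lemma sum_enum_val (R : realType) (T : finType) (F : T -> R) :
  \sum_x F x = \sum_(j < #|T|) F (enum_val j).
Proof. by rewrite -(big_enum_val F); apply: eq_bigl. Qed.

Lemma operator_mxE (R : realType) (T : finType) (A : (T -> R) -> T -> R)
    (u : T -> R) (i : 'I_#|T|) :
  linear_op A ->
  A u (enum_val i) = \sum_j operator_mx A i j * u (enum_val j).
Proof.
move=> linA; under eq_bigr do rewrite mxE mulrC.
rewrite -linear_op_sum//; congr (A _ _); apply/funext => y.
rewrite -(sum_enum_val (fun x => u x * (y == x)%:R)).
rewrite (bigD1 y)//= eqxx mulr1 big1 ?addr0// => x /negPf.
by rewrite eq_sym => ->; rewrite mulr0.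
Qed.

Lemma wdot_delta (R : realType) (T : finType) (m u : T -> R) (y : T) :
  wdot m u (fun x => (x == y)%:R) = m y * u y.
Proof.
rewrite /wdot (bigD1 y)//= eqxx mulr1 big1 ?addr0// => x /negPf ->.
by rewrite !mulr0.
Qed.

Lemma wdotC (R : realType) (T : finType) (m u v : T -> R) :
  wdot m u v = wdot m v u.
Proof. by apply: eq_bigr => x _; rewrite [u x * _]mulrC. Qed.

(** Conjugation by the diagonal matrix of [sqrt m] makes the matrix of [A] symmetric. The same [d]
    lists the roots of the characteristic polynomial and the eigenvalues of a basis, which keeps
    track of multiplicities. *)
Lemma selfadjoint_diagonalization (R : realType) (T : finType) (m : T -> R)
    (A : (T -> R) -> T -> R) :
  (forall x, 0 < m x) -> linear_op A -> selfadjoint_op m A ->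
  exists (d : 'I_#|T| -> R) (phi : 'I_#|T| -> T -> R),
  [/\ char_poly (operator_mx A) = \prod_i ('X - (d i)%:P),
      forall i x, A (phi i) x = d i * phi i x,
      forall u : T -> R, exists c, u = fun x => \sum_i c i * phi i x &
      forall c, (forall x, \sum_i c i * phi i x = 0) -> forall i, c i = 0].
Proof.
move=> m0 linA symA; set M := operator_mx A.
pose q (i : 'I_#|T|) : R := Num.sqrt (m (enum_val i)).
have q0 i : q i != 0 by rewrite gt_eqF// sqrtr_gt0.
have q2 i : m (enum_val i) = q i * q i by rewrite -expr2 sqr_sqrtr// ltW.
(* Self-adjointness tested on two indicator functions. *)
have symM i j : m (enum_val i) * M i j = m (enum_val j) * M j i.
  have := symA (fun x => (x == enum_val j)%:R) (fun x => (x == enum_val i)%:R).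
  by rewrite [RHS]wdotC !wdot_delta !mxE.
pose S : 'M[R]_#|T| := \matrix_(i, j) (q i * M i j / q j).
have symS : S^T = S.
  apply/matrixP => i j; have := symM i j; rewrite !q2 => H.
  rewrite mxE [LHS]mxE [RHS]mxE.
  by apply/eqP; rewrite eqr_div// mulrAC -H; apply/eqP; ring.
have [P Pu [d PS]] := symmetric_mx_diagonalization symS.
pose D : 'M[R]_#|T| := diag_mx (\row_i q i).
have Du : D \in unitmx.
  by rewrite unitmxE det_diag unitfE; apply/prodf_neq0 => i _; rewrite mxE.
(* As [S] is symmetric, the rows of [P] are also right eigenvectors of [S]; dividing by [sqrt m]
   undoes the conjugation. *)
exists (fun i => d 0 i), (fun i x => P i (enum_rank x) / Num.sqrt (m x)); split.
- have -> : char_poly M = char_poly S.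
    apply: (char_poly_similar Du); apply/matrixP => i j.
    rewrite mul_diag_mx mul_mx_diag !mxE.
    by rewrite mulfVK.
  rewrite (char_poly_similar Pu PS) char_poly_trig ?diag_mx_is_trig//.
  by apply: eq_bigr => i _; rewrite mxE eqxx.
- move=> i x; rewrite -[x]enum_rankK; move: (enum_rank x) => k.
  rewrite operator_mxE//; have /matrixP/(_ i k) := PS.
  rewrite mul_diag_mx !mxE enum_valK mulrA => <-.
  rewrite mulr_suml; apply: eq_bigr => j _; rewrite enum_valK -/M -/(q j) -/(q k).
  have -> : S j k = S k j by rewrite -{1}symS mxE.
  by rewrite [S k j]mxE; field; rewrite !q0.
- move=> u; pose r : 'rV[R]_#|T| := \row_j (q j * u (enum_val j)).
  exists (fun i => (r *m invmx P) 0 i); apply/funext => x.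
  under eq_bigr do rewrite mulrA; rewrite -mulr_suml.
  have /matrixP/(_ 0 (enum_rank x)) := mulmxKV Pu r.
  rewrite mxE => ->; rewrite mxE enum_rankK mulrC mulrA /q enum_rankK mulVf ?mul1r//.
  by rewrite gt_eqF// sqrtr_gt0.
- move=> c c0; pose r : 'rV[R]_#|T| := \row_i c i.
  suff /matrixP r0 : r = 0 by move=> i; have := r0 0 i; rewrite !mxE.
  rewrite -[r](mulmxK Pu); have -> : r *m P = 0; last by rewrite mul0mx.
  apply/rowP => k; have := c0 (enum_val k); rewrite !mxE.
  under eq_bigr do rewrite mulrA; rewrite -mulr_suml => /eqP.
  rewrite mulf_eq0 invr_eq0 (negPf (q0 k)) orbF => /eqP c0k.
  rewrite -[RHS]c0k.
  by apply: eq_bigr => i _; rewrite mxE enum_valK.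
Qed.

Lemma wdot_sum (R : realType) (T : finType) (m : T -> R) (I J : finType)
    (c : I -> R) (e : J -> R) (f : I -> T -> R) (g : J -> T -> R) :
  wdot m (fun x => \sum_i c i * f i x) (fun x => \sum_j e j * g j x) =
  \sum_i \sum_j c i * e j * wdot m (f i) (g j).
Proof.
under [RHS]eq_bigr => i _ do under eq_bigr => j _ do rewrite mulr_sumr.
under [RHS]eq_bigr => i _ do rewrite exchange_big /=.
rewrite [RHS]exchange_big; apply: eq_bigr => x _.
rewrite big_distrlr mulr_sumr; apply: eq_bigr => i _.
rewrite mulr_sumr; apply: eq_bigr => j _. rewrite /=; ring.
Qed.

Lemma wdot_ge0 (R : realType) (T : finType) (m u : T -> R) :
  (forall x, 0 < m x) -> 0 <= wdot m u u.
Proof.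
by move=> m0; apply: sumr_ge0 => x _; rewrite mulr_ge0 ?(ltW (m0 x))// -expr2 sqr_ge0.
Qed.

Lemma wdot_gt0 (R : realType) (T : finType) (m u : T -> R) (x : T) :
  (forall x, 0 < m x) -> u x != 0 -> 0 < wdot m u u.
Proof.
move=> m0 ux; rewrite /wdot (bigD1 x)//= ltr_wpDr//.
  by apply: sumr_ge0 => y _; rewrite mulr_ge0 ?(ltW (m0 y))// -expr2 sqr_ge0.
by rewrite mulr_gt0// -expr2 exprn_even_gt0.
Qed.

(** Expanding [u] in an eigenbasis turns information on eigenvalues into a bound on the quadratic
    form. *)
Lemma selfadjoint_op_ge0 (R : realType) (T : finType) (m : T -> R)
    (A : (T -> R) -> T -> R) :
  (forall x, 0 < m x) -> linear_op A -> selfadjoint_op m A ->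
  (forall a phi x, phi x != 0 -> (forall y, A phi y = a * phi y) -> 0 <= a) ->
  forall u, 0 <= wdot m (A u) u.
Proof.
move=> m0 linA symA eig u.
have [d [phi [_ dphi span free]]] := selfadjoint_diagonalization m0 linA symA.
have d0 i : 0 <= d i.
  have [x phix] : exists x, phi i x != 0.
    apply: contrapT => /forallNP phi0.
    have /free/(_ i)/eqP : forall x, \sum_k (k == i)%:R * phi k x = 0.
      move=> x; rewrite (bigD1 i)//= big1 => [|k /negPf ->]; last by rewrite mul0r.
      by apply/eqP; rewrite eqxx mul1r addr0; apply/negPn/negP/phi0.
    by rewrite eqxx oner_eq0.
  exact: eig phix (dphi i).
have [c ->] := span u.
have -> : A (fun x => \sum_i c i * phi i x) =
          fun x => \sum_i (d i * c i) * phi i x.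
  apply/funext => x; rewrite linear_op_sum//; apply: eq_bigr => i _.
  by rewrite dphi; ring.
(* Eigenfunctions for distinct eigenvalues are orthogonal, so the weight [d i]
   may be replaced by [sqrt (d i) * sqrt (d j)], which makes the form a square. *)
suff -> : wdot m (fun x => \sum_i (d i * c i) * phi i x)
                 (fun x => \sum_i c i * phi i x) =
          wdot m (fun x => \sum_i (Num.sqrt (d i) * c i) * phi i x)
                 (fun x => \sum_i (Num.sqrt (d i) * c i) * phi i x).
  exact: wdot_ge0.
rewrite !wdot_sum; apply: eq_bigr => i _; apply: eq_bigr => j _.
have := symA (phi i) (phi j).
rewrite (_ : A (phi i) = fun x => d i * phi i x); last exact/funext.
rewrite (_ : A (phi j) = fun x => d j * phi j x); last exact/funext.
have -> : wdot m (fun x => d i * phi i x) (phi j) = d i * wdot m (phi i) (phi j).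
  by rewrite /wdot mulr_sumr; apply: eq_bigr => x _; ring.
have -> : wdot m (phi i) (fun x => d j * phi j x) = d j * wdot m (phi i) (phi j).
  by rewrite /wdot mulr_sumr; apply: eq_bigr => x _; ring.
move=> /eqP; rewrite -subr_eq0 -mulrBl mulf_eq0 => /orP[|/eqP ->]; last first.
  by rewrite !mulr0.
rewrite subr_eq0 => /eqP <-.
have := sqr_sqrtr (d0 i); rewrite expr2 => {1}<-; ring.
Qed.

(** * Green's formula and the Dirichlet energy *)

(** Exchanging [x] and [y] in the double sum, the weight being symmetric, gives a second expression;
    the right-hand side is the average of the two. *)
Lemma green (R : realType) (V : finType) (G : weighted_graph R V)
    (u v : V -> R) :
  wdot (meas G) (laplacian G u) v =
  2^-1 * \sum_x \sum_y (u x - u y) * (v x - v y) * weight G x y.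
Proof.
have -> : wdot (meas G) (laplacian G u) v =
    \sum_x \sum_y (u x - u y) * v x * weight G x y.
  apply: eq_bigr => x _; rewrite /laplacian !mulrA mulfV ?gt_eqF ?meas_gt0//.
  by rewrite mul1r mulr_suml; apply: eq_bigr => y _; ring.
set S := LHS.
have SE : S = \sum_x \sum_y (u y - u x) * v y * weight G x y.
  rewrite /S exchange_big /=; apply: eq_bigr => x _; apply: eq_bigr => y _.
  by rewrite weight_sym.
suff -> : \sum_x \sum_y (u x - u y) * (v x - v y) * weight G x y = S + S by lra.
rewrite {2}SE /S. rewrite -[RHS]big_split; apply: eq_bigr => x _.
rewrite /= -[RHS]big_split; apply: eq_bigr => y _ /=; ring.
Qed.

Lemma laplacian_linear (R : realType) (V : finType) (G : weighted_graph R V) :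
  linear_op (laplacian G).
Proof.
move=> a u v x; rewrite /laplacian mulrCA -mulrDr; congr (_ * _).
rewrite mulr_sumr -big_split/=.
by apply: eq_bigr => y _; ring.
Qed.

Lemma laplacian_selfadjoint (R : realType) (V : finType)
    (G : weighted_graph R V) : selfadjoint_op (meas G) (laplacian G).
Proof.
move=> u v; rewrite [RHS]wdotC !green; congr (_ * _).
by apply: eq_bigr => x _; apply: eq_bigr => y _; rewrite [(u x - u y) * _]mulrC.
Qed.

Lemma laplacian_addc (R : realType) (V : finType) (G : weighted_graph R V)
    (u : V -> R) (t : R) : laplacian G (fun x => u x + t) = laplacian G u.
Proof.
apply/funext => x; congr (_ * _); apply: eq_bigr => y _.
by congr (_ * _); ring.
Qed.

Lemma laplacian_cst (R : realType) (V : finType) (G : weighted_graph R V)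
    (t : R) (x : V) : laplacian G (fun=> t) x = 0.
Proof. by rewrite /laplacian big1 ?mulr0// => y _; rewrite subrr mul0r. Qed.

Lemma sum_laplacian (R : realType) (V : finType) (G : weighted_graph R V)
    (u : V -> R) : \sum_x meas G x * laplacian G u x = 0.
Proof.
transitivity (wdot (meas G) (laplacian G u) (fun=> 1)).
  by apply: eq_bigr => x _; rewrite mulr1.
rewrite laplacian_selfadjoint /wdot big1// => x _.
by rewrite laplacian_cst !mulr0.
Qed.

Lemma weight_ge0 (R : realType) (V : finType) (G : weighted_graph R V) x y :
  0 <= weight G x y.
Proof.
by case: (boolP (edge G x y)) => [/weight_gt0/ltW|/weight_eq0 ->].
Qed.

(** The energy is a sum of nonnegative terms, so its vanishing forces equal values across each edge;
    connectedness propagates this to all of [V]. *)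
Lemma energy_eq0_cst (R : realType) (V : finType) (G : weighted_graph R V)
    (u : V -> R) :
  connected_graph G -> wdot (meas G) (laplacian G u) u = 0 ->
  forall x y, u x = u y.
Proof.
move=> conn; rewrite green => /eqP; rewrite mulf_eq0 invr_eq0 pnatr_eq0/=.
have t0 x y : 0 <= (u x - u y) * (u x - u y) * weight G x y.
  by rewrite mulr_ge0 ?weight_ge0// -expr2 sqr_ge0.
rewrite psumr_eq0 => [/allP E0|x _]; last exact: sumr_ge0.
have edge_eq x y : edge G x y -> u x = u y.
  move=> xy; have := E0 x (mem_index_enum x); rewrite psumr_eq0//.
  move=> /allP/(_ y (mem_index_enum y)); rewrite /= !mulf_eq0 orbb.
  by rewrite (gt_eqF (weight_gt0 xy)) orbF subr_eq0 => /eqP.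
move=> x y; have cl : fingraph.closed (edge G) [pred z | u z == u x].
  by move=> z t /edge_eq zt; rewrite !inE zt.
by have := fingraph.closed_connect cl (conn x y); rewrite !inE eqxx => /esym/eqP.
Qed.

(** * From eigenvalue bounds to a Poincare inequality *)

Lemma poincare_of_eigenvalue_bound (R : realType) (V : finType)
    (G : weighted_graph R V) (c : R) :
  (forall a phi x y, phi x != phi y ->
     (forall z, laplacian G phi z = a * phi z) -> c <= a) ->
  forall u, \sum_x meas G x * u x = 0 ->
    c * wdot (meas G) u u <= wdot (meas G) (laplacian G u) u.
Proof.
move=> eig u u0; pose m := meas G; pose M := \sum_x m x.
pose mean (f : V -> R) := \sum_x m x * f x.
(* Subtracting [c] and shifting the constants back to eigenvalue 0 leaves an
   operator without negative eigenvalues. *)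
pose A f x := laplacian G f x - c * f x + c / M * mean f.
have meanL a f g : mean (fun x => a * f x + g x) = a * mean f + mean g.
  by rewrite /mean mulr_sumr -big_split; apply: eq_bigr => x _ /=; ring.
have linA : linear_op A.
  by move=> a f g x; rewrite /A laplacian_linear meanL; ring.
have AE f g : wdot m (A f) g =
    wdot m (laplacian G f) g - c * wdot m f g + c / M * mean f * mean g.
  rewrite /wdot /A; move: (mean f) => s; rewrite /mean !mulr_sumr -sumrB.
  by rewrite -big_split; apply: eq_bigr => x _ /=; ring.
have symA : selfadjoint_op m A.
  move=> f g; rewrite [RHS]wdotC !AE laplacian_selfadjoint.
  rewrite [wdot m g _]wdotC [wdot m (laplacian G g) f]wdotC.
  by ring.
have m0 x : 0 < m x by exact: meas_gt0.
have eigA a phi x : phi x != 0 -> (forall y, A phi y = a * phi y) -> 0 <= a.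
  move=> phix phiE.
  have M0 : M != 0.
    rewrite gt_eqF// /M (bigD1 x)//= ltr_wpDr//.
    by apply: sumr_ge0 => y _; rewrite ltW.
  (* [A] annihilates constants, so by self-adjointness [a] or the mean of [phi] is zero. In the
     latter case [phi] is nonconstant and a Laplacian eigenfunction for [a + c], whence
     [c <= a + c]. *)
  have : a * mean phi = 0.
    transitivity (wdot m (A phi) (fun=> 1)).
      by rewrite /mean mulr_sumr; apply: eq_bigr => y _; rewrite phiE; ring.
    rewrite symA /wdot big1// => y _; rewrite /A laplacian_cst /mean.
    by under eq_bigr do rewrite mulr1; rewrite -/M; field.
  move=> /eqP; rewrite mulf_eq0 => /orP[/eqP ->//|/eqP mean0].
  have [y phiy] : exists y, phi x != phi y.
    apply: contrapT => /forallNP cst; move: mean0; rewrite /mean.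
    under eq_bigr => y _.
      have /negP/negPn/eqP <- := cst y; over.
    by rewrite -mulr_suml => /eqP; rewrite mulf_eq0 (negPf M0) (negPf phix).
  have : c <= a + c.
    apply: eig phiy _ => z; have := phiE z; rewrite /A mean0 => H; lra.
  lra.
have := selfadjoint_op_ge0 m0 linA symA eigA u.
by rewrite AE {1}/mean u0 -/m; lra.
Qed.

(** * The Neumann extension and the Neumann Laplacian *)

Lemma linear_op_surj (R : realType) (T : finType) (A : (T -> R) -> T -> R) :
  linear_op A -> (forall u, (forall x, A u x = 0) -> forall x, u x = 0) ->
  forall w, exists u, forall x, A u x = w x.
Proof.
move=> linA injA w; pose M := operator_mx A.
(* The matrix is transposed because functions are represented by row vectors here. *)
have MTu : M^T \in unitmx.
  rewrite -row_free_unit; apply: inj_row_free => r rM.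
  have r0 := injA (fun x => r 0 (enum_rank x)).
  apply/rowP => k; rewrite mxE -[k]enum_valK; apply: r0 => x.
  rewrite -[x]enum_rankK operator_mxE//.
  have /rowP/(_ (enum_rank x)) := rM; rewrite mxE [RHS]mxE => rM0.
  rewrite -[RHS]rM0.
  by apply: eq_bigr => j _; rewrite enum_valK [M^T _ _]mxE mulrC.
pose r := (\row_j w (enum_val j)) *m invmx M^T.
exists (fun x => r 0 (enum_rank x)) => x.
rewrite -[x]enum_rankK operator_mxE//.
have /rowP/(_ (enum_rank x)) := mulmxKV MTu (\row_j w (enum_val j)).
rewrite -/r mxE [RHS]mxE => <-.
by apply: eq_bigr => j _; rewrite enum_valK [M^T _ _]mxE mulrC.
Qed.

(** At each vertex [v] or its Laplacian vanishes, so the energy is zero and [v] is constant; the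
    interior vertex [z] fixes the constant to be 0. *)
Lemma harmonic_extension_inj (R : realType) (V : finType)
    (G : weighted_graph R V) (B : {set V}) (z : interior_vertex B)
    (v : V -> R) :
  connected_graph G -> (forall y : interior_vertex B, v (val y) = 0) ->
  (forall x, x \in B -> laplacian G v x = 0) -> forall x, v x = 0.
Proof.
move=> conn vint vB x; rewrite -(vint z).
apply: (energy_eq0_cst conn); rewrite /wdot big1// => y _.
case: (boolP (y \in B)) => [/vB ->|yB]; first by rewrite mul0r mulr0.
have yi : y \in ~: B by rewrite inE.
by have := vint (Sub y yi); rewrite SubK => ->; rewrite !mulr0.
Qed.

Lemma neumann_extensionP (R : realType) (V : finType)
    (G : weighted_graph R V) (B : {set V}) (z : interior_vertex B)
    (u : interior_vertex B -> R) :
  connected_graph G -> is_neumann_extension G u (neumann_extension G u).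
Proof.
move=> conn; rewrite /neumann_extension.
(* The extension problem as one square system on [V]: values prescribed in the interior, harmonicity
   on [B]. Injectivity of [A] then gives existence. *)
pose A f x := if x \in B then laplacian G f x else f x.
have linA : linear_op A.
  by move=> a f g x; rewrite /A; case: ifP => // _; rewrite laplacian_linear.
have injA f : (forall x, A f x = 0) -> forall x, f x = 0.
  move=> f0; apply: (harmonic_extension_inj z conn) => [y|x xB].
    have := f0 (val y); rewrite /A; have := valP y.
    by rewrite inE => /negPf ->.
  by have := f0 x; rewrite /A xB.
pose w x := if insub x is Some y then u y else 0.
have [v vE] := linear_op_surj linA injA w.
apply: (xgetPex _ _); exists v; split => [y|x xB].
  have := vE (val y); rewrite /A /w valK; have := valP y.
  by rewrite inE => /negPf ->.
have := vE x; rewrite /A xB /w insubF//.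
by rewrite inE xB.
Qed.

Lemma neumann_extension_uniq (R : realType) (V : finType)
    (G : weighted_graph R V) (B : {set V}) (z : interior_vertex B)
    (u : interior_vertex B -> R) (v : V -> R) :
  connected_graph G -> is_neumann_extension G u v ->
  neumann_extension G u = v.
Proof.
move=> conn [vu vB]; have [nu nB] := neumann_extensionP z u conn.
apply/funext => x; apply/eqP; rewrite -subr_eq0 addrC -mulN1r; apply/eqP.
(* The difference of the two extensions, in the shape [a * u + v] expected by [linear_op]. *)
apply: (harmonic_extension_inj (v := fun x => -1 * v x + _ x) z conn).
  by move=> y; rewrite vu nu; ring.
by move=> y yB; rewrite laplacian_linear vB// nB// mulr0 addr0.
Qed.

Lemma neumann_extension_linear (R : realType) (V : finType)
    (G : weighted_graph R V) (B : {set V}) (z : interior_vertex B)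
    (a : R) (u v : interior_vertex B -> R) :
  connected_graph G ->
  neumann_extension G (fun y => a * u y + v y) =
  fun x => a * neumann_extension G u x + neumann_extension G v x.
Proof.
move=> conn; apply: (neumann_extension_uniq z) => //.
have [uu uB] := neumann_extensionP z u conn.
have [vv vB] := neumann_extensionP z v conn.
split=> [y|x xB]; first by rewrite uu vv.
by rewrite laplacian_linear uB// vB// mulr0 addr0.
Qed.

Lemma neumann_laplacian_linear (R : realType) (V : finType)
    (G : weighted_graph R V) (B : {set V}) (z : interior_vertex B) :
  connected_graph G -> linear_op (neumann_laplacian G (B := B)).
Proof.
move=> conn a u v x.
by rewrite /neumann_laplacian (neumann_extension_linear z)// laplacian_linear.
Qed.

(** The Laplacian of the extension vanishes on [B], so the pairing over [V] sees only the interior,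
    whatever the values of [v] on [B]. *)
Lemma neumann_green (R : realType) (V : finType)
    (G : weighted_graph R V) (B : {set V}) (z : interior_vertex B)
    (u : interior_vertex B -> R) (v : V -> R) :
  connected_graph G ->
  wdot (fun y => meas G (val y)) (neumann_laplacian G u) (fun y => v (val y)) =
  wdot (meas G) (laplacian G (neumann_extension G u)) v.
Proof.
move=> conn; have [_ uB] := neumann_extensionP z u conn.
rewrite [RHS]/wdot (bigID (mem (~: B)))/= [X in _ + X]big1 ?addr0.
  rewrite (big_sub _ (fun x => meas G x * (laplacian G _ x * v x))).
  by apply: eq_bigr.
by move=> x; rewrite inE negbK => xB; rewrite uB// mul0r mulr0.
Qed.

Lemma neumann_laplacian_selfadjoint (R : realType) (V : finType)
    (G : weighted_graph R V) (B : {set V}) (z : interior_vertex B) :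
  connected_graph G ->
  selfadjoint_op (fun y : interior_vertex B => meas G (val y))
    (neumann_laplacian G (B := B)).
Proof.
move=> conn u v.
have [/funext uu _] := neumann_extensionP z u conn.
have [/funext vv _] := neumann_extensionP z v conn.
rewrite [RHS]wdotC -{2}uu -{1}vv !(neumann_green z)//.
by rewrite laplacian_selfadjoint wdotC.
Qed.

(** * The second Neumann eigenvalue *)

Lemma neumann_eigenvalue_bound (R : realType) (V : finType)
    (G : weighted_graph R V) (B : {set V}) (c a : R)
    (u : interior_vertex B -> R) (y z : interior_vertex B) :
  connected_graph G ->
  (forall v, \sum_x meas G x * v x = 0 ->
    c * wdot (meas G) v v <= wdot (meas G) (laplacian G v) v) ->
  u y != u z -> (forall t, neumann_laplacian G u t = a * u t) -> 0 < c -> c <= a.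
Proof.
move=> conn poinc uyz uE c0.
have [uu uB] := neumann_extensionP z u conn.
set v := neumann_extension G u in uu uB.
pose mO := fun t : interior_vertex B => meas G (val t).
have mO0 t : 0 < mO t by exact: meas_gt0.
(* Applied below with [g] equal to [v], to the constant 1 and to [v + s]. *)
have green_u g : a * wdot mO u (fun t => g (val t)) =
    wdot (meas G) (laplacian G v) g.
  rewrite -(neumann_green z)// /wdot mulr_sumr; apply: eq_bigr => t _.
  by rewrite uE /mO; ring.
have vu : (fun t => v (val t)) = u by exact/funext.
have U0 : 0 < wdot mO u u.
  case: (eqVneq (u y) 0) => [y0|]; last exact: wdot_gt0.
  by apply: (@wdot_gt0 _ _ _ _ z) => //; rewrite eq_sym -y0.
(* If [a] were 0, the energy of [v] would vanish and [v] would be constant. *)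
have a0 : a != 0.
  apply/eqP => a0; move: uyz; rewrite -!uu (_ : v _ = v (val z)) ?eqxx//.
  by apply: (energy_eq0_cst conn); rewrite -green_u a0 mul0r.
have mean0 : wdot mO u (fun=> 1) = 0.
  have := green_u (fun=> 1); rewrite laplacian_selfadjoint [RHS]big1.
    by move/eqP; rewrite mulf_eq0 (negPf a0) => /eqP.
  by move=> x _; rewrite laplacian_cst !mulr0.
pose M := \sum_x meas G x.
have M0 : M != 0.
  rewrite gt_eqF// /M (bigD1 (val z))//= ltr_wpDr ?meas_gt0//.
  by apply: sumr_ge0 => x _; rewrite ltW ?meas_gt0.
(* [v] minus its mean is an admissible test function; passing from its norm
   on [V] to the norm of [u] on the interior only decreases it, since [u] is
   orthogonal to the constants there. *)
pose s := - (\sum_x meas G x * v x) / M.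
have := poinc (fun x => v x + s).
have -> : \sum_x meas G x * (v x + s) = 0.
  under eq_bigr do rewrite mulrDr; rewrite big_split/= -mulr_suml -/M /s.
  by field.
rewrite laplacian_addc => /(_ erefl) H.
have {}H : c * wdot (meas G) (fun x => v x + s) (fun x => v x + s) <=
    a * wdot mO u u.
  apply: (le_trans H); rewrite -green_u -vu.
  suff -> : wdot mO (fun t => v (val t)) (fun t => v (val t) + s) =
      wdot mO (fun t => v (val t)) (fun t => v (val t)) by [].
  rewrite vu; transitivity (wdot mO u u + s * wdot mO u (fun=> 1)).
    by rewrite /wdot mulr_sumr -big_split; apply: eq_bigr => t _ /=; rewrite -vu; ring.
  by rewrite mean0 mulr0 addr0.
have L : wdot mO u u <= wdot (meas G) (fun x => v x + s) (fun x => v x + s).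
  have -> : wdot mO u u = wdot mO (fun t => u t + s) (fun t => u t + s)
      - s ^+ 2 * \sum_t mO t - 2 * s * wdot mO u (fun=> 1).
    rewrite /wdot !mulr_sumr -!sumrB; apply: eq_bigr => t _.
    by ring.
  rewrite mean0 mulr0 subr0; set X := wdot mO _ _.
  have : X <= wdot (meas G) (fun x => v x + s) (fun x => v x + s).
    rewrite [leRHS]/wdot (bigID (mem (~: B)))/=.
    rewrite (big_sub _ (fun x => meas G x * ((v x + s) * (v x + s)))).
    rewrite -[X]addr0 lerD//.
      by rewrite /X -vu.
    by apply: sumr_ge0 => x _; rewrite mulr_ge0 ?(ltW (meas_gt0 _ _))// -expr2 sqr_ge0.
  have : 0 <= s ^+ 2 * \sum_t mO t.
    by rewrite mulr_ge0 ?sqr_ge0// sumr_ge0// => t _; exact: ltW.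
  lra.
rewrite -(ler_pM2r U0); apply: le_trans H.
by rewrite ler_pM2l.
Qed.

(** The sorted values of [d] satisfy the defining predicate, so [xget] does not fall back on its
    default; unique factorization then determines the roots with multiplicity. *)
Lemma eigenvalues_perm (R : realType) (n : nat) (A : 'M[R]_n)
    (d : 'I_n -> R) :
  char_poly A = \prod_i ('X - (d i)%:P) ->
  sorted <=%R (eigenvalues A) /\ perm_eq (eigenvalues A) (codom d).
Proof.
move=> Ad.
have Ad' : char_poly A = \prod_(a <- codom d) ('X - a%:P).
  by rewrite Ad /codom /image_mem big_map big_enum.
have [sorted_s charE] : [set s : seq R | sorted <=%R s /\
    char_poly A = \prod_(a <- s) ('X - a%:P)]%classic (eigenvalues A).
  apply: (xgetPex _ _); exists (sort <=%R (codom d)).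
  split; first by apply: sort_sorted; exact: le_total.
  by rewrite Ad'; apply: perm_big; rewrite perm_sym perm_sort.
by split=> //; apply: prod_XsubC_eq; rewrite -Ad' -charE.
Qed.

Lemma neumann_eigenvalue2_ge (R : realType) (V : finType)
    (G : weighted_graph R V) (B : {set V}) (c : R) :
  connected_graph G -> 0 < c ->
  (forall v, \sum_x meas G x * v x = 0 ->
    c * wdot (meas G) v v <= wdot (meas G) (laplacian G v) v) ->
  (c%:E <= neumann_eigenvalue G B 2)%E.
Proof.
move=> conn c0 poinc; rewrite /neumann_eigenvalue; case: ifP => [B2|_]; last first.
  exact: leey.
rewrite lee_fin leNgt; apply/negP => lt_c.
have [z0 z0B] : exists z, z \in ~: B.
  by apply/set0Pn; rewrite -card_gt0; apply: leq_trans B2.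
pose z : interior_vertex B := Sub z0 z0B.
have [d [phi [dchar dphi _ free]]] := selfadjoint_diagonalization
  (fun y : interior_vertex B => meas_gt0 G (val y))
  (neumann_laplacian_linear z conn) (neumann_laplacian_selfadjoint z conn).
have cst i : d i < c -> exists t, forall y, phi i y = t.
  move=> dic; exists (phi i z) => y; apply/eqP/negPn/negP => yz.
  have := neumann_eigenvalue_bound conn poinc yz (dphi i) c0.
  by rewrite leNgt dic.
have [s_sorted s_perm] := eigenvalues_perm dchar.
have card_interior : #|interior_vertex B| = #|~: B| by rewrite card_sig.
move: lt_c; set s := eigenvalues _ in s_sorted s_perm * => lt_c.
(* Positions count from 0: entry 1 is the second eigenvalue, and entry 0 lies below it by
   sortedness. *)
have : (1 < count (< c)%R s)%N.
  have := perm_size s_perm; rewrite size_codom card_ord card_interior => sz.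
  move: sz s_sorted lt_c; case: (s) => [|a [|b r]] /=.
  - by move=> sz; rewrite -sz in B2.
  - by move=> sz; rewrite -sz in B2.
  - by move=> _ /andP[ab _] bc; rewrite bc (le_lt_trans ab bc).
have /permP -> := s_perm.
have -> : count (< c)%R (codom d) = #|[pred i | d i < c]|.
  rewrite [RHS]cardE /enum_mem size_filter /codom /image_mem count_map enumT.
  exact: eq_count.
move=> /card_gt1P [i [j []]]; rewrite !inE => /cst[si phi_i] /cst[sj phi_j] ij.
(* Both eigenfunctions are constant, so [sj * phi i - si * phi j] vanishes and independence gives
   [sj = 0]. Then [phi j] is zero, which independence also excludes. *)
have phi_j0 : sj = 0.
  have /free/(_ i) : forall x,
      \sum_k (if k == i then sj else if k == j then - si else 0) * phi k x = 0.
    move=> x; rewrite (bigD1 i)//= (bigD1 j) 1?eq_sym//= big1.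
      by rewrite eqxx eq_sym (negPf ij) eqxx phi_i phi_j; ring.
    by move=> k /andP[/negPf -> /negPf ->]; rewrite mul0r.
  by rewrite eqxx.
have /free/(_ j)/eqP : forall x, \sum_k (k == j)%:R * phi k x = 0.
  move=> x; rewrite (bigD1 j)//= big1 => [|k /negPf ->]; last by rewrite mul0r.
  by rewrite phi_j phi_j0 mulr0 addr0.
by rewrite eqxx oner_eq0.
Qed.

(** * The Bakry-Emery condition *)

Lemma laplacianZ (R : realType) (V : finType) (G : weighted_graph R V)
    (b : R) (u : V -> R) (x : V) :
  laplacian G (fun y => b * u y) x = b * laplacian G u x.
Proof.
have := laplacian_linear G b u (fun=> 0) x.
by rewrite laplacian_cst addr0 => <-; congr (laplacian G _ x); apply/funext => y; rewrite addr0.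
Qed.

Lemma GammaZr (R : realType) (V : finType) (G : weighted_graph R V)
    (b : R) (f g : V -> R) (x : V) :
  Gamma G f (fun y => b * g y) x = b * Gamma G f g x.
Proof.
rewrite /Gamma /gen laplacianZ.
rewrite (_ : (fun y => f y * (b * g y)) = fun y => b * (f y * g y)); last first.
  by apply/funext => y; ring.
by rewrite laplacianZ; ring.
Qed.

(** The term [L (f * f)] has integral zero, which leaves only the two products of [f] with [L f]. *)
Lemma sum_Gamma (R : realType) (V : finType) (G : weighted_graph R V)
    (f : V -> R) :
  \sum_x meas G x * Gamma G f f x = wdot (meas G) (laplacian G f) f.
Proof.
transitivity (wdot (meas G) (laplacian G f) f
    - 2^-1 * \sum_x meas G x * laplacian G (fun y => f y * f y) x).
  rewrite /wdot mulr_sumr -sumrB; apply: eq_bigr => x _.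
  by rewrite /Gamma /gen; field.
by rewrite sum_laplacian mulr0 subr0.
Qed.

(** The energy of [phi] is [a] times its squared norm, and on a connected graph a nonconstant
    function has positive energy. *)
Lemma eigenvalue_gt0 (R : realType) (V : finType) (G : weighted_graph R V)
    (a : R) (phi : V -> R) (x y : V) :
  connected_graph G -> phi x != phi y ->
  (forall z, laplacian G phi z = a * phi z) ->
  0 < a /\ 0 < wdot (meas G) phi phi.
Proof.
move=> conn xy phiE.
have E : wdot (meas G) (laplacian G phi) phi = a * wdot (meas G) phi phi.
  by rewrite /wdot mulr_sumr; apply: eq_bigr => z _; rewrite phiE; ring.
have U0 : 0 < wdot (meas G) phi phi.
  case: (eqVneq (phi x) 0) => [x0|x0].
    by apply: (@wdot_gt0 _ _ _ _ y (meas_gt0 G)); rewrite eq_sym -x0.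
  exact: wdot_gt0 (meas_gt0 G) x0.
split=> //; rewrite -(pmulr_lgt0 _ U0) -E lt_neqAle eq_sym; apply/andP; split.
  by apply: contra xy => /eqP/(energy_eq0_cst conn) cst; apply/eqP/cst.
rewrite green mulr_ge0 ?invr_ge0// sumr_ge0// => z _; apply: sumr_ge0 => t _.
by rewrite mulr_ge0 ?weight_ge0// -expr2 sqr_ge0.
Qed.

Lemma bakry_emery_eigenvalue_bound (R : realType) (V : finType)
    (G : weighted_graph R V) (K n a : R) (phi : V -> R) (x y : V) :
  connected_graph G -> 1 < n -> bakry_emery_CD G K n ->
  phi x != phi y -> (forall z, laplacian G phi z = a * phi z) ->
  n * K / (n - 1) <= a.
Proof.
move=> conn n1 cd xy phiE; have [a0 U0] := eigenvalue_gt0 conn xy phiE.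
set U := wdot _ _ _ in U0.
have genE : gen G phi = fun z => - a * phi z.
  by apply/funext => z; rewrite /gen phiE mulNr.
have sG : \sum_z meas G z * Gamma G phi phi z = a * U.
  rewrite sum_Gamma /U /wdot mulr_sumr; apply: eq_bigr => z _.
  by rewrite phiE; ring.
(* The first term of [Gamma2] is a generator term with integral zero; in the second,
   [L phi = - a * phi] pulls out a factor [a]. *)
have sG2 : \sum_z meas G z * Gamma2 G phi z = a ^+ 2 * U.
  transitivity (a * (\sum_z meas G z * Gamma G phi phi z)
      - 2^-1 * \sum_z meas G z * laplacian G (Gamma G phi phi) z).
    rewrite !mulr_sumr -sumrB; apply: eq_bigr => z _.
    by rewrite /Gamma2 genE GammaZr /gen; ring.
  by rewrite sum_laplacian mulr0 subr0 sG; ring.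
have : n^-1 * a ^+ 2 * U + K * (a * U) <= a ^+ 2 * U.
  rewrite -sG2 -sG /U /wdot !mulr_sumr -big_split.
  apply: ler_sum => z _ /=.
  have := ler_wpM2l (ltW (meas_gt0 G z)) (cd phi z); apply: le_trans.
  by rewrite {1}genE le_eqVlt; apply/orP; left; apply/eqP; ring.
(* Cancelling [a * U > 0] leaves [a / n + K <= a], which is then solved for [a]. *)
have -> : n^-1 * a ^+ 2 * U + K * (a * U) = (n^-1 * a + K) * (a * U) by ring.
rewrite expr2 -mulrA ler_pM2r ?mulr_gt0// => H.
have n0 : 0 < n by lra.
rewrite ler_pdivrMr ?subr_gt0// -(ler_pM2l n0) in H *.
move: H; rewrite mulrDr mulrA mulfV ?gt_eqF//; lra.
Qed.

(** * The Ollivier curvature *)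

(** The default [#|V|] is positive because [V] contains [x], and a path of length 0 would force
    [x = y]. *)
Lemma graph_dist_gt0 (R : realType) (V : finType) (G : weighted_graph R V)
    (x y : V) : x != y -> (0 < graph_dist G x y)%N.
Proof.
move=> xy; rewrite /graph_dist; apply: (big_ind (fun k => 0 < k)%N).
- by apply/card_gt0P; exists x.
- by move=> i j i0 j0; rewrite leq_min i0.
- move=> [[|k] ?]//= /existsP[p]; rewrite tuple0 /= => /eqP xyE.
  by rewrite xyE eqxx in xy.
Qed.

(* A 1-Lipschitz multiple of the eigenfunction that attains its Lipschitz
   constant at a pair of points is a test function for the curvature there. *)
Lemma ollivier_eigenvalue_bound (R : realType) (V : finType)
    (G : weighted_graph R V) (kappa a : R) (phi : V -> R) (x y : V) :
  ollivier_lower_bound G kappa ->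
  phi x != phi y -> (forall z, laplacian G phi z = a * phi z) ->
  kappa <= a.
Proof.
move=> olb xy phiE.
pose dist z t : R := (graph_dist G z t)%:R.
have dist0 z t : z != t -> 0 < dist z t.
  by move=> zt; rewrite /dist ltr0n graph_dist_gt0.
pose slope (p : V * V) := `|phi p.1 - phi p.2| / dist p.1 p.2.
(* The slope is maximized over pairs of distinct points; [(x, y)] is one of them and makes the
   maximum [L] positive. *)
have xy' : (x, y).1 != (x, y).2 by apply: contra_neq xy => /= ->.
case: (@Order.TotalTheory.arg_maxP _ _ _ (x, y) (fun p : V * V => p.1 != p.2) slope xy').
move=> [z t] /= zt maxL; set L := slope (z, t) in maxL.
have L0 : 0 < L.
  apply: lt_le_trans (maxL (x, y) xy').
  by rewrite /slope divr_gt0 ?dist0// normr_gt0 subr_eq0.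
have zt_phi : phi t - phi z != 0.
  apply: contraTneq L0 => zt0.
  by rewrite /L /slope/= distrC zt0 normr0 mul0r ltxx.
(* The sign makes [f] increase from [z] to [t]; division by [L] normalizes the Lipschitz constant to
   1. *)
pose k := Num.sg (phi t - phi z) / L.
pose f v := k * phi v.
have f_lip : lipschitz1 G f.
  move=> v w; rewrite -mulrBr normrM /k normrM normr_sg zt_phi mul1r.
  rewrite normfV (gtr0_norm L0).
  have [->|vw] := eqVneq v w; first by rewrite subrr normr0 mulr0.
  rewrite ler_pdivrMl// -/(dist v w) -ler_pdivrMr ?dist0//.
  exact: (maxL (v, w)).
have f_zt : f t - f z = dist z t.
  rewrite -mulrBr /k mulrAC -normrEsg distrC /L /slope/=.
  by rewrite invf_div mulrCA mulfV ?mulr1// normr_eq0 -opprB oppr_eq0.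
apply: (@le_trans _ _ ((laplacian G f t - laplacian G f z) / dist z t)).
  rewrite -lee_fin; apply: le_trans (olb z t zt) _.
  by apply: ereal_inf_lbound; exists f.
rewrite !laplacianZ !phiE.
have -> : k * (a * phi t) - k * (a * phi z) = a * (f t - f z).
  by rewrite /f; ring.
by rewrite f_zt mulfK// gt_eqF ?dist0.
Qed.

Theorem theorem1p8 (R : realType) (V : finType) (G : weighted_graph R V)
    (B : {set V}) (B_neq0 : B != finset.set0) (G_conn : connected_graph G) :
  (forall K n : R, 0 < K -> 1 < n -> bakry_emery_CD G K n ->
     ((n * K / (n - 1))%:E <= neumann_eigenvalue G B 2)%E) /\
  (forall kappa : R, 0 < kappa -> ollivier_lower_bound G kappa ->
     (kappa%:E <= neumann_eigenvalue G B 2)%E).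
Proof.
split=> [K n K0 n1 cd|kappa kappa0 olb].
  apply: neumann_eigenvalue2_ge => //.
    by rewrite divr_gt0 ?mulr_gt0 ?subr_gt0// (lt_trans ltr01).
  apply: poincare_of_eigenvalue_bound => a phi x y.
  exact: bakry_emery_eigenvalue_bound.
apply: neumann_eigenvalue2_ge => //.
apply: poincare_of_eigenvalue_bound => a phi x y.
exact: ollivier_eigenvalue_bound.
Qed.
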